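(* Let $n\geq 3$ be an integer. Then there exist constants $c_1(n),c_2(n)>0$, depending only on $n$, such that $$c_1(n)\ \leq\ \sup_{T}\ \frac{\sum_{a\in G(T)}\mathrm{F}(a)/(a_1a_2\cdots a_n)^{\frac{1}{n-1}}}{\#G(T)}\ \leq\ c_2(n),$$ where the supremum is over all positive integers $T$.
   Context: For an integer vector $a=(a_1,\dots,a_n)\in\mathbb{Z}_{>0}^n$ with $\gcd(a_1,\dots,a_n)=1$, the Frobenius number of $a$ is $\mathrm{F}(a)=\max\{b\in\mathbb{Z} : b\neq \langle a,z\rangle \text{ for all } z\in\mathbb{Z}_{\geq 0}^n\}$, where $\langle\cdot,\cdot\rangle$ is the standard inner product; i.e. $\mathrm{F}(a)$ is the largest integer that is not a non-negative integral combination of $a_1,\dots,a_n$ (it can be negative: it equals $-1$ if some $a_i=1$). For a positive integer $T$, $G(T)=\{a\in\mathbb{Z}_{>0}^n : \gcd(a_1,\dots,a_n)=1,\ \max_i a_i\leq T\}$, a finite nonempty set, and $\#G(T)$ is its cardinality. *)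

(* Defs.v *)
From HB Require Import structures.
From mathcomp Require Import all_boot all_order all_algebra.
From mathcomp Require Import all_classical all_reals all_analysis.

Set Implicit Arguments.
Unset Strict Implicit.
Unset Printing Implicit Defensive.

Import Order.TTheory GRing.Theory Num.Theory.

Local Open Scope classical_set_scope.
Local Open Scope ring_scope.

(* Positive integer vectors are nat-valued functions on 'I_n (positivity and
   coprimality are imposed in primitive_vec); F(a) itself is in int because it
   is -1 when some a_i = 1. *)

Definition dot n (a z : 'I_n -> nat) : nat := (\sum_(i < n) a i * z i)%N.

Definition nonrep n (a : 'I_n -> nat) : set int :=
  [set b : int | forall z : 'I_n -> nat, b <> (dot a z)%:Z].

(* The maximum of nonrep a; the default 0 is never used when a is primitive,
   see frobeniusP. *)
Definition frobenius n (a : 'I_n -> nat) : int :=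
  xget 0 (nonrep a `&` ubound (nonrep a)).

Definition primitive_vec n (a : 'I_n -> nat) : bool :=
  [forall i, (0 < a i)%N] && (\big[gcdn/0%N]_(i < n) a i == 1%N).

(* The bound max_i a_i <= T is carried by the codomain 'I_T.+1 = {0, ..., T}. *)
Definition G n T : {set {ffun 'I_n -> 'I_T.+1}} :=
  [set a : {ffun 'I_n -> 'I_T.+1} | primitive_vec (fun i => a i : nat)].

Definition normalized_frobenius (R : realType) n (a : 'I_n -> nat) : R :=
  (frobenius a)%:~R / ((\prod_(i < n) (a i)%:R) `^ (n%:R - 1)^-1).

Definition average_frobenius (R : realType) n T : R :=
  (\sum_(a in G n T) normalized_frobenius R (fun i => a i : nat)) / #|G n T|%:R.

Lemma dotD n (a z w : 'I_n -> nat) (k l : nat) :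
  dot a (fun i => k * z i + l * w i)%N = (k * dot a z + l * dot a w)%N.
Proof.
rewrite /dot !big_distrr -big_split; apply: eq_bigr => i _ /=.
by rewrite mulnDr !(mulnCA (a i)).
Qed.

Lemma bezout_vec n (a : 'I_n -> nat) :
  exists u v, dot a u = (\big[gcdn/0%N]_(i < n) a i + dot a v)%N.
Proof.
apply: (big_ind (fun g => exists u v, dot a u = (g + dot a v)%N)).
- by exists (fun=> 0%N), (fun=> 0%N).
- move=> x y [ux [vx hx]] [uy [vy hy]].
  have [->|x0] := posnP x; first by rewrite gcd0n; exists uy, vy.
  have [l _ /dvdnP[k hk]] := Bezoutl y x0.
  exists (fun i => k * ux i + l * vy i)%N, (fun i => k * vx i + l * uy i)%N.
  by rewrite !dotD hx hy !mulnDr -hk -!addnA; congr addn; rewrite addnCA addnA.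
- move=> i _; exists (fun j => j == i : nat), (fun=> 0%N).
  rewrite /dot (bigD1 i) //= eqxx muln1; congr addn.
  by rewrite !big1// => j; [rewrite muln0 | move=> /negPf ->; rewrite muln0].
Qed.

Lemma large_dot n (a : 'I_n -> nat) : \big[gcdn/0%N]_(i < n) a i = 1%N ->
  exists N0, forall N, (N0 <= N)%N -> exists z, N = dot a z.
Proof.
move=> g1; have [u [v]] := bezout_vec a; rewrite g1 add1n => uv.
exists (dot a v * dot a v)%N => N hN.
have [m0|m0] := posnP (dot a v).
  exists (fun i => N * u i + 0 * v i)%N.
  by rewrite dotD uv m0 muln1 mul0n addn0.
have hq : (N %% dot a v <= N %/ dot a v)%N.
  by rewrite ltnW// (leq_trans (ltn_pmod _ m0))// leq_divRL.
exists (fun i => N %% dot a v * u i + (N %/ dot a v - N %% dot a v) * v i)%N.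
rewrite dotD uv mulnS -addnA -mulnDl subnKC// addnC.
exact: divn_eq.
Qed.

Lemma frobeniusP n (a : 'I_n -> nat) : primitive_vec a ->
  nonrep a (frobenius a) /\ ubound (nonrep a) (frobenius a).
Proof.
move=> /andP[_ /eqP/large_dot[N0 hN0]].
suff : exists b, (nonrep a `&` ubound (nonrep a)) b by move=> /(xgetPex 0).
pose P k := `[< nonrep a (k%:Z - 1) >].
have exP : exists k, P k by exists 0%N; apply/asboolP => z.
have ubP k : P k -> (k <= N0)%N.
  move=> /asboolP hk; rewrite leqNgt; apply/negP => lt.
  have /hN0[z hz] : (N0 <= k.-1)%N by case: k lt {hk}.
  apply: (hk z); rewrite -hz; case: k lt {hk hz} => // k _ /=.
  by rewrite -natz -addn1 natrD addrK natz.
case: (ex_maxnP exP ubP) => k /asboolP hk kmax.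
exists (k%:Z - 1); split=> // b hb.
have [b0|b0] := ltP b 0; first by rewrite lerBrDr (le_trans (y := 0)) // -ltzD1 ltrD2r.
case: b hb b0 => // m hm _; rewrite lerBrDr -PoszD addn1 lez_nat.
by apply: kmax; apply/asboolP; rewrite -addn1 PoszD addrK.
Qed.

Lemma G_gt0 n T : (0 < n)%N -> (0 < T)%N -> (0 < #|G n T|)%N.
Proof.
case: n => // n _ T0; pose a : {ffun 'I_n.+1 -> 'I_T.+1} := [ffun=> inord 1].
have a1 i : a i = 1%N :> nat by rewrite ffunE inordK.
apply/card_gt0P; exists a; rewrite inE /primitive_vec big_ord_recl a1 gcd1n.
by rewrite eqxx andbT; apply/forallP => i; rewrite a1.
Qed.

(* Main.v *)
Require Import Defs.
From mathcomp Require Import all_boot all_order all_algebra.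
From mathcomp Require Import all_classical all_reals all_analysis.
From mathcomp Require Import cyclic zify ring lra.

(** Write [n = p + 1], with [p >= 2], and fix a primitive vector [a].

Upper bound on one Frobenius number.  Let [m] be one entry of [a] and [b] the
vector of the other [p] entries.  If every residue class modulo [m] contains
some [b . x] with [0 <= x_i <= Y_i], then [F(a) <= b . Y] ([frobenius_le]).  A
box [0 <= x_i < X_i] has [B = X_1 ... X_p] points, so one expects it to reach
most classes once [B] is a large multiple of [m]; taking [X_i] inversely
proportional to [b_i] then gives [F(a)] the order of magnitude
[(a_1 ... a_n) ^ (1 / p)] of the normalization.  Whether the expectation holds
for a given [b] is measured by the number [E] of pairs of points of the box with
the same residue: by Cauchy-Schwarz at least [B ^ 2 / E] classes are reached,
and once more than half of them are reached, every class is a sum of two reached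
ones ([attained_add]), so that doubling the box suffices.

Average over [b].  The quantity [m E / B ^ 2 - gcd(m, b)], called the excess, is
nonnegative, and for primitive vectors it is at least 1 whenever half of the
classes, or more, are missed.  Its sum over all [b] modulo [m] is computable: the equation
[b . z = 0] has [m ^ (p - 1) gcd(m, z)] solutions modulo [m] ([card_kernel]), and
expanding gcds as sums of totients over the common divisors [d] gives
([sum_excess_le]) [m ^ p] times at most
[sum_(d | m) phi(d) (prod_i (1 / d + 1 / X_i) - d ^ -p)].
The subtracted gcd is responsible for the term [- d ^ -p]: it removes the vectors
with all entries divisible by [d], which cover badly but are not primitive.

Dyadic classes.  The vectors are sorted by the integers [e_i] such that
[2 ^ e_i <= a_i < 2 ^ (e_i + 1)], and [m] is the entry with the smallest [e_i]:
the other entries then run over intervals of length at least [m / 2], hence are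
equidistributed modulo [m] up to a constant.  With [f] the integer part of
[(sum_i e_i) / p] and [X_i] close to [2 ^ t 2 ^ f / 2 ^ e_i], the proportion of
vectors of excess at least 1 is at most a constant times
[2 ^ (- p t) + log T max_i 2 ^ e_i / (2 ^ t 2 ^ f)] ([sum_excess_side]).  These
are the vectors for which [F(a)] may exceed [2 ^ t] times the normalization, up
to a constant, so the proportions are summed with weights [2 ^ t]
([layer_cake]).  The first terms then give a convergent series, because [p >= 2].
The second terms, added over the [O(log T)] values of [t] and over the
[O((log T) ^ n)] classes, contribute [O(T ^ (n - 1 / p) (log T) ^ (n + 2))], which
is [O(T ^ n)].  Since [G n T] has at least [T ^ n / 2] elements ([card_G_ge]), the
averages are bounded.

Lower bound.  One value of [T] with a positive average is enough.  Negative
Frobenius numbers are equal to [-1] and need an entry equal to 1, which occurs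
for at most [n T ^ (n - 1)] vectors; if all entries exceed [h] then
[F(a) >= h].  For [h = T / (4 n)] the latter holds for at least [T ^ n / 4]
vectors, while the normalization is at most [T ^ (3 / 2)], so the positive part
has order [T ^ (n - 1 / 2)] and wins for large [T]. *)

Set Implicit Arguments.
Unset Strict Implicit.
Unset Printing Implicit Defensive.

Import Order.TTheory GRing.Theory Num.Theory.

Local Notation vec x := (fun i => nat_of_ord (x i)).

(** * Congruences and divisors *)

(** After a translation to [s = 0], the elements of one class are determined by
their quotients by [d], which are at most [(X - 1) / d]. *)
Lemma count_mod_le s X d l : 0 < d ->
  (\sum_(s <= k < s + X) (k == l %[mod d])) * d <= X + d.
Proof.
move=> d0.
wlog -> : s l / s = 0.
  move=> h; rewrite -{1}[s]add0n big_addn addKn.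
  rewrite (eq_bigr (fun k : nat => (k == l + s * d.-1 %[mod d]) : nat)).
    by rewrite -[X in index_iota 0 X]add0n; exact: (h 0).
  move=> k _; congr nat_of_bool; rewrite -(eqn_modDr (s * d.-1)) -addnA -mulnS prednK//.
  by rewrite addnC modnMDl.
rewrite add0n.
have -> : \sum_(0 <= k < X) (k == l %[mod d]) =
    size [seq k <- iota 0 X | k == l %[mod d]].
  by rewrite size_filter -sum1_count [in RHS]big_mkcond /= /index_iota subn0.
set s' := seq.filter _ _.
have inj : {in s' &, injective (fun k => k %/ d)}.
  move=> x y; rewrite !mem_filter => /andP[/eqP hx _] /andP[/eqP hy _] /= e.
  by rewrite (divn_eq x d) (divn_eq y d) e hx hy.
have /uniq_leq_size : uniq (map (fun k => k %/ d) s').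
  by rewrite map_inj_in_uniq// filter_uniq// iota_uniq.
case: X @s' inj => [|X] s' inj; first by rewrite /s' /=.
move=> /(_ (iota 0 (X %/ d).+1)); rewrite size_map size_iota => h.
have : size s' * d <= (X %/ d).+1 * d.
  rewrite leq_mul2r h ?orbT// => _ /mapP[k hk ->].
  move: hk; rewrite mem_filter !mem_iota !add0n /= !ltnS => /andP[_ ?].
  exact: leq_div2r.
by have := leq_divM X d; lia.
Qed.

(** The subtractions of a Bezout identity become multiplications by [m - 1], so that
the coefficients [w] are natural numbers. *)
Lemma bezout_mod m p (z : 'I_p -> nat) : 0 < m ->
  exists w : 'I_p -> nat, dot w z = gcdn m (\big[gcdn/0]_i z i) %[mod m].
Proof.
move=> m0; have [u [v uv]] := bezout_vec z; set g0 := \big[_/_]_i _ in uv *.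
have [k _ hk] := Bezoutl g0 m0.
exists (fun i => (m.-1 * k) * u i + (m.-1 * k) * (m.-1 * v i)).
have -> : dot (fun i => m.-1 * k * u i + m.-1 * k * (m.-1 * v i)) z =
   m.-1 * k * (dot z u + m.-1 * dot z v).
  rewrite /dot [m.-1 * (\sum_i _)]big_distrr -big_split big_distrr /=.
  by apply: eq_bigr => i _; lia.
have -> : m.-1 * k * (dot z u + m.-1 * dot z v) = (m.-1 * k * dot z v) * m + m.-1 * k * g0.
  by rewrite uv; case: m m0 {hk} => // m _ /=; lia.
rewrite modnMDl; have [q hq] := dvdnP hk.
apply/eqP; rewrite -(eqn_modDr (gcdn m g0 + k * g0)).
have -> : m.-1 * k * g0 + (gcdn m g0 + k * g0) = (k * g0) * m + gcdn m g0.
  by case: m m0 {hk hq} => // m _ /=; lia.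
by rewrite modnMDl hq addnC modnMDl.
Qed.

(** The values [b . z] modulo [m] are multiples of [g = gcd(m, z)], and adding
multiples of the Bezout vector of [z] moves the kernel injectively onto the
fibres of all [m / g] of them. *)
Lemma card_kernel m p (z : 'I_p -> nat) : 0 < m ->
  #|[set b : {ffun 'I_p -> 'I_m} | m %| dot (vec b) z]| * m <=
    m ^ p * gcdn m (\big[gcdn/0]_i z i).
Proof.
move=> m0; have [w hw] := bezout_mod z m0; set g := gcdn _ _ in hw *.
set K := [set b | _].
have gm : g %| m by rewrite dvdn_gcdl.
have g0 : 0 < g by rewrite gcdn_gt0 m0.
pose f (bt : {ffun 'I_p -> 'I_m} * 'I_(m %/ g)) : {ffun 'I_p -> 'I_m} :=
  [ffun i => Ordinal (ltn_pmod (bt.1 i + bt.2 * w i) m0)].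
have hf b t : b \in K -> dot (vec (f (b, t))) z = t * g %[mod m].
  rewrite inE => /dvdnP[q hq].
  have -> : dot (vec (f (b, t))) z = dot (fun i => b i + t * w i) z %[mod m].
    rewrite /dot -modn_summ -[in RHS]modn_summ; congr (_ %% m).
    by apply: eq_bigr => i _; rewrite ffunE /= modnMml.
  have -> : dot (fun i => b i + t * w i) z = dot (vec b) z + t * dot w z.
    by rewrite /dot big_distrr -big_split; apply: eq_bigr => i _ /=; lia.
  by rewrite hq modnMDl -modnMmr hw modnMmr.
have inj : {in [set bt | bt.1 \in K] &, injective f}.
  move=> [b t] [b' t']; rewrite !inE /= => hb hb' e.
  have tt : t = t'.
    have lt (u : 'I_(m %/ g)) : u * g < m.
      by rewrite -[ltnRHS](divnK gm) ltn_mul2r g0 ltn_ord.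
    have := hf b t; rewrite inE hb => /(_ isT).
    rewrite e hf ?inE// !modn_small// => /eqP; rewrite eqn_mul2r gtn_eqF//=.
    by move=> /eqP/val_inj ->.
  subst t'; congr pair; apply/ffunP => i.
  have /ffunP/(_ i) := e; rewrite !ffunE => /(congr1 val)/= /eqP.
  by rewrite eqn_modDr !modn_small// => /eqP/val_inj.
have := max_card [in f @: [set bt | bt.1 \in K]].
rewrite (card_in_imset inj).
have -> : [set bt : {ffun 'I_p -> 'I_m} * 'I_(m %/ g) | bt.1 \in K] = finset.setX K [set: _].
  by apply/setP => -[b t]; rewrite !inE andbT.
rewrite cardsX cardsT card_ord card_ffun !card_ord => h.
by rewrite -[X in _ * X <= _](divnK gm) mulnA leq_mul2r h orbT.
Qed.

Lemma prod_bool_forall p (P : 'I_p -> bool) : \prod_i (P i : nat) = [forall i, P i].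
Proof.
case: forallP => [h|/forallP/forallPn[i /negPf hi]].
  by rewrite big1// => i _; rewrite h.
by rewrite (bigD1 i)//= hi mul0n.
Qed.

(** The identity [k = sum_(d | k) phi(d)] for the gcd [k], with the condition that
[d] divides every entry written as a product over the entries: sums over vectors
of such products factor. *)
Lemma gcd_sum_totient m p (z : 'I_p -> nat) : 0 < m ->
  gcdn m (\big[gcdn/0]_i z i) =
  \sum_(d < m.+1 | d %| m) totient d * \prod_i (d %| z i).
Proof.
move=> m0; set g := gcdn _ _.
have g0 : 0 < g by rewrite gcdn_gt0 m0.
have gm : g.+1 <= m.+1 by rewrite ltnS dvdn_leq// dvdn_gcdl.
rewrite -{1}[g]sum_totient_dvd (big_ord_widen_cond _ (fun d => d %| g) totient gm).
rewrite big_mkcond [RHS]big_mkcond; apply: eq_bigr => d _ /=.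
rewrite prod_bool_forall ltnS.
have -> : (d %| g) && (d <= g) = (d %| m) && [forall i, d %| z i].
  rewrite andb_idr; last by move=> /dvdn_leq ->.
  rewrite dvdn_gcd; congr andb; apply/dvdn_biggcdP/forallP => h i; first exact: h.
  by move=> _; apply: h.
by case: (d %| m) => //=; case: ifP => _; rewrite ?muln1 ?muln0.
Qed.

(** Exactly [m / d] of the residues modulo [m] are multiples of a divisor [d]. *)
Lemma sum_gcd m p : 0 < m ->
  \sum_(b : {ffun 'I_p -> 'I_m}) gcdn m (\big[gcdn/0]_i b i) =
  \sum_(d < m.+1 | d %| m) totient d * (m %/ d) ^ p.
Proof.
move=> m0; under eq_bigr do rewrite gcd_sum_totient//.
rewrite exchange_big /=; apply: eq_bigr => d dm.
rewrite -big_distrr /=; congr muln.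
rewrite -(bigA_distr_bigA (fun _ (k : 'I_m) => (d %| k) : nat)) /=.
rewrite prod_nat_const card_ord; congr (_ ^ _).
rewrite divn_count_dvd -(big_mkord xpredT (fun k => (d %| k) : nat)).
case: m m0 d dm => // m _ d dm.
by rewrite big_nat_recl// big_add1 [RHS]big_nat_recr//= dvdn0 dm addnC.
Qed.

Lemma totient_le d : totient d <= d.
Proof.
rewrite totient_count_coprime -[leqRHS]muln1 -[X in _ <= X * _]subn0 -sum_nat_const_nat.
by apply: leq_sum => i _; exact: leq_b1.
Qed.

(** An interval of length [A >= m / 2] meets each class modulo [m] in at most
[A / m + 1 <= 3 A / m] points. *)
Lemma card_mod_window_le T A m c : 0 < m -> m <= 2 * A ->
  (\sum_(k < T | (A <= k < 2 * A) && (k == c %[mod m])) 1) * m <= 3 * A.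
Proof.
move=> m0 mA; rewrite -(big_mkord (fun k => (A <= k < 2 * A) && (k == c %[mod m])) (fun=> 1)).
have h : \sum_(0 <= k < T | (A <= k < 2 * A) && (k == c %[mod m])) 1 <=
         \sum_(A <= k < A + A) (k == c %[mod m]).
  rewrite (big_nat_widen 0 T (maxn T (A + A))) ?leq_maxl//.
  rewrite (@big_nat_widenl _ _ _ A 0)// (big_nat_widen 0 (A + A) (maxn T (A + A))) ?leq_maxr//.
  rewrite [leqLHS]big_mkcond [leqRHS]big_mkcond; apply: leq_sum => k _ /=.
  rewrite addnn -mul2n; case: (A <= k) => //=; case: (k < 2 * A) => //=.
  by case: (k < T) => //=; rewrite ?andbT ?andbF//=; case: eqP.
rewrite (leq_trans (leq_mul h (leqnn m)))// (leq_trans (count_mod_le _ _ _ _))//.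
by lia.
Qed.

(** * Boxes and the residues they reach *)

(** Sum [2 f(i) f(j) <= f(i) ^ 2 + f(j) ^ 2] over all pairs. *)
Lemma Cauchy_Schwarz_nat (I : finType) (D : {set I}) (f : I -> nat) :
  (\sum_(i in D) f i) ^ 2 <= #|D| * \sum_(i in D) f i ^ 2.
Proof.
rewrite -(leq_pmul2l (_ : 0 < 2))//.
have -> : 2 * (\sum_(i in D) f i) ^ 2 =
    \sum_(i in D) \sum_(j in D) 2 * (f i * f j).
  rewrite -mulnn big_distrl big_distrr /=; apply: eq_bigr => i _.
  by rewrite big_distrr big_distrr.
apply: (@leq_trans (\sum_(i in D) \sum_(j in D) (f i ^ 2 + f j ^ 2))).
  by apply: leq_sum => i _; apply: leq_sum => j _; exact: nat_Cauchy.
under eq_bigr do rewrite big_split sum_nat_const /=.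
by rewrite big_split -big_distrr sum_nat_const /= mul2n addnn.
Qed.

(** The codomain is a common bound for the sides, so that the points of a box have a
type that does not depend on the coordinate. *)
Definition box p (X : 'I_p -> nat) : {set {ffun 'I_p -> 'I_(\max_i X i)}} :=
  [set x : {ffun 'I_p -> 'I_(\max_i X i)} | [forall i, x i < X i]].

Lemma sum_box_prod p (X : 'I_p -> nat) (F : 'I_p -> nat -> nat) :
  \sum_(x in box X) \prod_i F i (x i) = \prod_i \sum_(k < X i) F i k.
Proof.
transitivity (\prod_i \sum_(k < \max_i X i | k < X i) F i k).
  rewrite bigA_distr_big_dep; apply: eq_bigl => x; rewrite inE.
  by apply/forallP/familyP.
by apply: eq_bigr => i _; rewrite -big_ord_widen// leq_bigmax.
Qed.

Lemma card_box p (X : 'I_p -> nat) : #|box X| = \prod_i X i.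
Proof.
transitivity (\prod_i \sum_(k < X i) 1).
  by rewrite -(sum_box_prod X (fun _ _ => 1)) -sum1_card; apply: eq_bigr => x _; rewrite big1.
by apply: eq_bigr => i _; rewrite sum1_card card_ord.
Qed.

(** This is the additive energy of the map [x |-> b . x mod m] on the box: the number
of its collisions, the diagonal included. *)
Definition energy m p (b X : 'I_p -> nat) : nat :=
  \sum_(x in box X) \sum_(y in box X) (dot b (vec x) == dot b (vec y) %[mod m]).

Definition attained m p (b X : 'I_p -> nat) : {set 'I_m} :=
  [set r : 'I_m | [exists x in box X, dot b (vec x) %% m == r]].

(** Cauchy-Schwarz for the number of representations of each class: these numbers add
up to the size of the box, and their squares to the energy. *)
Lemma card_box_energy m p (b X : 'I_p -> nat) : 0 < m ->
  #|box X| ^ 2 <= #|attained m b X| * energy m b X.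
Proof.
move=> m0.
pose f (r : 'I_m) := \sum_(x in box X) (dot b (vec x) %% m == r).
have sum_at (x : {ffun 'I_p -> 'I_(\max_i X i)}) (h : 'I_m -> nat) : x \in box X ->
    \sum_(r in attained m b X) (dot b (vec x) %% m == r) * h r =
    h (Ordinal (ltn_pmod (dot b (vec x)) m0)).
  move=> hx; rewrite (bigD1 (Ordinal (ltn_pmod (dot b (vec x)) m0))) /=; last first.
    by rewrite inE; apply/exists_inP; exists x.
  rewrite eqxx mul1n [X in _ + X]big1 ?addn0// => r /andP[_ /negPf].
  by rewrite -val_eqE /= eq_sym => ->; rewrite mul0n.
have <- : \sum_(r in attained m b X) f r = #|box X|.
  rewrite exchange_big -sum1_card; apply: eq_bigr => x hx.
  rewrite -[RHS](sum_at x (fun=> 1))//.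
  by apply: eq_bigr => r _; rewrite muln1.
suff <- : \sum_(r in attained m b X) f r ^ 2 = energy m b X.
  exact: Cauchy_Schwarz_nat.
transitivity (\sum_(x in box X) \sum_(r in attained m b X)
    (dot b (vec x) %% m == r) * f r).
  rewrite exchange_big; apply: eq_bigr => r _.
  by rewrite -mulnn {1}/f big_distrl.
apply: eq_bigr => x hx; rewrite sum_at//; apply: eq_bigr => y _ /=.
by rewrite eq_sym.
Qed.

(** Exchanging the sums, a pair [(x, y)] of points of the box counts the [b] with
[b . (x - y) = 0] modulo [m]; their number involves [gcd(m, x - y)], whose totient
expansion turns the sum over the pairs into a product over the coordinates. *)
Lemma sum_energy_le m p (X : 'I_p -> nat) : 0 < m ->
  (\sum_(b : {ffun 'I_p -> 'I_m}) energy m (vec b) X) * m <=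
  m ^ p * \sum_(d < m.+1 | d %| m) totient d *
     \prod_i \sum_(k < X i) \sum_(l < X i) (k == l %[mod d]).
Proof.
move=> m0.
have step (x y : {ffun 'I_p -> 'I_(\max_i X i)}) :
   (\sum_(b : {ffun 'I_p -> 'I_m})
      (dot (vec b) (vec x) == dot (vec b) (vec y) %[mod m])) * m <=
    m ^ p * \sum_(d < m.+1 | d %| m) totient d * \prod_i (x i == y i %[mod d]).
  pose z i := x i + m.-1 * y i.
  (* [m - 1] stands for [-1], as [d] divides [m]. *)
  have mod_sub d u v : d %| m -> (u == v %[mod d]) = (d %| u + m.-1 * v).
    move=> dm; rewrite -(eqn_modDr (m.-1 * v)) -mulSn prednK// /dvdn.
    by rewrite [X in _ == X](_ : _ = 0)// -modnMml (eqP dm) mul0n mod0n.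
  have := card_kernel z m0; rewrite (gcd_sum_totient z m0).
  rewrite -sum1dep_card big_mkcond /=.
  rewrite (eq_bigr (fun b : {ffun 'I_p -> 'I_m} =>
      (dot (vec b) (vec x) == dot (vec b) (vec y) %[mod m]) : nat)); last first.
    move=> b _; rewrite mod_sub//.
    have -> : dot (vec b) z = dot (vec b) (vec x) + m.-1 * dot (vec b) (vec y).
      rewrite /dot big_distrr -big_split; apply: eq_bigr => i _ /=.
      by rewrite mulnDr mulnCA.
    by case: (_ %| _).
  move=> /leq_trans -> //; rewrite leq_mul2l; apply/orP; right.
  apply: leq_sum => d dm; rewrite leq_mul2l; apply/orP; right.
  by apply: leq_prod => i _; rewrite mod_sub.
have -> : (\sum_(b : {ffun 'I_p -> 'I_m}) energy m (vec b) X) * m =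
  \sum_(x in box X) \sum_(y in box X) (\sum_(b : {ffun 'I_p -> 'I_m})
      (dot (vec b) (vec x) == dot (vec b) (vec y) %[mod m])) * m.
  rewrite exchange_big big_distrl; apply: eq_bigr => x _.
  by rewrite exchange_big big_distrl.
apply: (@leq_trans (\sum_(x in box X) \sum_(y in box X)
   m ^ p * \sum_(d < m.+1 | d %| m) totient d * \prod_i (x i == y i %[mod d]))).
  by apply: leq_sum => x _; apply: leq_sum => y _; exact: step.
under eq_bigr do rewrite -big_distrr /=.
rewrite -big_distrr leq_mul2l; apply/orP; right => /=.
under eq_bigr do rewrite exchange_big /=.
rewrite exchange_big /=; apply: leq_sum => d _.
under eq_bigr do rewrite -big_distrr /=.
rewrite -big_distrr leq_mul2l; apply/orP; right => /=.
under eq_bigr => x _.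
  rewrite (sum_box_prod X (fun i k => x i == k %[mod d])); over.
by rewrite (sum_box_prod X (fun i l => \sum_(k < X i) (l == k %[mod d]))).
Qed.

(** All reached classes are multiples of the gcd. *)
Lemma card_attained m p (b X : 'I_p -> nat) : 0 < m ->
  #|attained m b X| * gcdn m (\big[gcdn/0]_i b i) <= m.
Proof.
move=> m0; set g := gcdn _ _.
have gm : g %| m by rewrite dvdn_gcdl.
have g0 : 0 < g by rewrite gcdn_gt0 m0.
have lt (u : 'I_(m %/ g)) : u * g < m.
  by rewrite -[ltnRHS](divnK gm) ltn_mul2r g0 ltn_ord.
rewrite -[leqRHS](divnK gm) leq_mul2r; apply/orP; right.
rewrite -[leqRHS]card_ord -cardsT.
apply: leq_trans (leq_imset_card (fun u => Ordinal (lt u)) _).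
apply/subset_leq_card/fintype.subsetP => r; rewrite inE => /exists_inP[x _ /eqP hr].
have gr : g %| r.
  rewrite -hr /dvdn modn_dvdm// -/(dvdn _ _) dvdn_sum// => i _.
  by rewrite dvdn_mulr// (dvdn_trans (dvdn_gcdr _ _))// (biggcdn_inf i).
have ltr : r %/ g < m %/ g by rewrite ltn_divLR// divnK.
by apply/imsetP; exists (Ordinal ltr) => //; apply/val_inj; rewrite /= divnK.
Qed.

(** The pigeonhole principle: the sets [D] and [r - D] both contain more than half of
the classes, so they meet. *)
Lemma attained_add m p (b X : 'I_p -> nat) : 0 < m ->
  m < 2 * #|attained m b X| ->
  forall r, exists x, exists y, [/\ x \in box X, y \in box X &
    dot b (vec x) + dot b (vec y) = r %[mod m]].
Proof.
move=> m0 hm r; set D := attained m b X in hm.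
pose f (s : 'I_m) := Ordinal (ltn_pmod (r + (m - s)) m0).
have f_inj : injective f.
  move=> s t /(congr1 val)/= /eqP; rewrite eqn_modDl => /eqP h; apply/val_inj => /=.
  have : (m - s + (s + t) = m - t + (s + t) %[mod m])%N.
    by rewrite -modnDml h modnDml.
  have hs := ltn_ord s; have ht := ltn_ord t.
  have -> : (m - s + (s + t) = m + t)%N by lia.
  have -> : (m - t + (s + t) = m + s)%N by lia.
  by rewrite !modnDl !modn_small.
have : ~~ [disjoint D & f @: D].
  apply/negP => /finset.disjoint_setI0 dis.
  have := cardsUI D (f @: D); rewrite dis cards0 addn0 card_imset// => h.
  have := max_card [in D :|: f @: D]; rewrite card_ord => h'.
  by move: hm; rewrite ltnNge mul2n -addnn -h => /negP; apply.
rewrite -finset.setI_eq0 => /finset.set0Pn[s /finset.setIP[]].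
rewrite inE => /exists_inP[x hx /eqP sx] /imsetP[t].
rewrite inE => /exists_inP[y hy /eqP ty] st.
exists x, y; split=> //; rewrite -modnDml -modnDmr sx ty st /= modnDml.
by rewrite -addnA subnK ?modnDr// ltnW.
Qed.

(** * Inequalities *)

Local Open Scope ring_scope.

Section Analysis.
Variable R : realFieldType.

(** Expand the product over subsets.  The two extreme terms are [u ^ p] and the
product of the [y i]; as [u] and the [y i] are at most 1, each of the others is at
most [u * y i] for some [i].  The constant [3 ^ p], larger than the number of
terms, is convenient for the induction. *)
Lemma prod_addl_le p (u : R) (y : 'I_p -> R) : 0 <= u <= 1 ->
  (forall i, 0 <= y i <= 1) ->
  \prod_i (u + y i) - u ^+ p <= \prod_i y i + 3 ^+ p * (u * \sum_i y i).
Proof.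
move=> /andP[u0 u1]; case: p y => [|p] y hy.
  by rewrite !big_ord0 expr0 !mulr0 subrr addr0.
elim: p y hy => [|p IH] y hy.
  rewrite !big_ord_recl !big_ord0; have /andP[y0 y1] := hy ord0.
  have : 0 <= u * y ord0 by rewrite mulr_ge0.
  by lra.
rewrite big_ord_recr [\prod_i y i]big_ord_recr [\sum_i _]big_ord_recr /=.
set y' := fun i => y (widen_ord (leqnSn p.+1) i).
rewrite -/(y' _).
have hy' i : 0 <= y' i <= 1 by exact: hy.
have /andP[y0 y1] := hy ord_max; set z := y ord_max in y0 y1 *.
have := IH y' hy'.
rewrite (eq_bigr (fun i => u + y' i))// [X in X * z](eq_bigr y')//.
rewrite (eq_bigr y')//.
set P := \prod_i (u + y' i); set Q := \prod_i y' i; set S := \sum_i y' i.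
have S0 : 0 <= S by apply: sumr_ge0 => i _; case/andP: (hy' i).
have Q0 : 0 <= Q by apply: prodr_ge0 => i _; case/andP: (hy' i).
(* The extra term [Q * u] of the induction step is absorbed by [u * S]. *)
have QS : Q <= S.
  rewrite /Q /S big_ord_recl [leRHS]big_ord_recl.
  rewrite -[leLHS]addr0 lerD//; last first.
    by apply: sumr_ge0 => i _; case/andP: (hy' (lift ord0 i)).
  have /andP[? ?] := hy' ord0.
  by rewrite ler_piMr// prodr_ile1// => i; exact: hy'.
have up : u ^+ p.+1 <= u by rewrite exprS ler_piMr// exprn_ile1.
have up0 : 0 <= u ^+ p.+1 by rewrite exprn_ge0.
have c1 : 1 <= 3 ^+ p.+1 :> R by rewrite exprn_ege1// ler1n.
rewrite [u ^+ p.+2]exprSr [3 ^+ p.+2]exprSr.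
set U := u ^+ p.+1 in up up0 *; set c := 3 ^+ p.+1 in c1 *.
move=> h.
have h1 : (P - U) * (u + z) <= (Q + c * (u * S)) * (u + z).
  by rewrite ler_wpM2r// addr_ge0.
have e1 : U * z <= u * z by rewrite ler_wpM2r.
have e2 : Q * u <= u * S by rewrite mulrC ler_wpM2l.
have uS : 0 <= u * S by rewrite mulr_ge0.
have uz : 0 <= u * z by rewrite mulr_ge0.
have e3 : c * (u * S) * (u + z) <= c * (u * S) * 2.
  by rewrite ler_wpM2l ?mulr_ge0//; lra.
have e4 : u * S <= c * (u * S) by rewrite ler_peMl.
have e5 : u * z <= c * 3 * (u * z) by rewrite ler_peMl//; lra.
have : c * 3 * (u * (S + z)) = c * (u * S) * 3 + c * 3 * (u * z) by ring.
nra.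
Qed.

(** Each dyadic block of the harmonic series contributes at most 1. *)
Lemma harmonic_dyadic e : \sum_(1 <= d < 2 ^ e.+1) d%:R^-1 <= e.+1%:R :> R.
Proof.
elim: e => [|e IH]; first by rewrite big_nat1 invr1.
have h : (2 ^ e.+1 <= 2 ^ e.+2)%N by rewrite leq_exp2l.
rewrite (big_cat_nat (n := 2 ^ e.+1)) ?expn_gt0//= -[X in _ <= X%:R]addn1 natrD lerD//.
apply: (@le_trans _ _ (\sum_(2 ^ e.+1 <= d < 2 ^ e.+2) (2 ^ e.+1)%:R^-1)).
  rewrite big_nat_cond [leRHS]big_nat_cond; apply: ler_sum => d /andP[/andP[d1 _] _].
  by rewrite lef_pV2 ?posrE ?ltr0n ?expn_gt0 ?ler_nat// (leq_trans _ d1)// expn_gt0.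
rewrite sumr_const_nat [(2 ^ e.+2)%N]expnS mul2n -addnn addnK.
by rewrite -[leLHS]mulr_natr mulVf ?pnatr_eq0 -?lt0n ?expn_gt0.
Qed.

Lemma geometric_half_le K : \sum_(t < K) 2^-1 ^+ t <= 2 :> R.
Proof.
suff -> : \sum_(t < K) 2^-1 ^+ t = 2 - 2 * 2^-1 ^+ K :> R.
  by rewrite gerBl mulr_ge0 ?exprn_ge0// invr_ge0.
elim: K => [|K IH]; first by rewrite big_ord0 expr0; ring.
by rewrite big_ord_recr /= IH exprS; field.
Qed.

(** A divisor [d] occurs for at most [M / d] values of [m], which compensates
[totient d <= d]. *)
Lemma sum_divisors_le (M : nat) (g : nat -> R) : (forall d, (0 < d)%N -> 0 <= g d) ->
  \sum_(1 <= m < M) \sum_(d < m.+1 | (d %| m)%N) (totient d)%:R * g d <=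
  M%:R * \sum_(1 <= d < M) g d.
Proof.
move=> g0.
apply: (@le_trans _ _ (\sum_(1 <= m < M) \sum_(1 <= d < M)
    (d %| m)%:R * ((totient d)%:R * g d))).
  rewrite big_nat_cond [leRHS]big_nat_cond; apply: ler_sum => m /andP[/andP[m1 mM] _].
  rewrite -(big_mkord (fun d => d %| m)%N (fun d => (totient d)%:R * g d)).
  rewrite big_mkcond big_ltn//= dvd0n (gtn_eqF m1) add0r.
  rewrite [leRHS](big_cat_nat (n := m.+1))//=.
  rewrite -[leLHS]addr0 lerD//.
    rewrite big_nat_cond [leRHS]big_nat_cond; apply: ler_sum => d /andP[/andP[d1 _] _].
    by case: (_ %| _)%N; rewrite ?mul1r// mul0r.
  rewrite big_nat_cond; apply: sumr_ge0 => d /andP[/andP[d1 _] _].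
  by rewrite !mulr_ge0// g0// (leq_trans _ d1).
rewrite exchange_big /= mulr_sumr.
rewrite big_nat_cond [leRHS]big_nat_cond; apply: ler_sum => d /andP[/andP[d1 _] _].
rewrite -mulr_suml mulrA ler_wpM2r ?g0// -natr_sum -natrM ler_nat.
case: M => [|M]; first by rewrite big_geq.
rewrite -divn_count_dvd (leq_trans (leq_mul (leqnn _) (totient_le d)))//.
by rewrite (leq_trans (leq_divM _ _)).
Qed.

(** Only the last failing level matters: if [g t >= 1] there and the next level is
good, then [F] is at most [c * 2 ^ (t + 1)], a term of the sum. *)
Lemma layer_cake (F c : R) (g : nat -> R) K : 0 <= c ->
  (forall t, (t < K)%N -> g t < 1 -> F <= c * 2 ^+ t) -> F <= c * 2 ^+ K ->
  (forall t, (t < K)%N -> 0 <= g t) ->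
  F <= c * (1 + \sum_(t < K) 2 ^+ t.+1 * g t).
Proof.
move=> c0; elim: K => [|K IH] hg hK g0.
  by rewrite big_ord0 addr0; rewrite expr0 in hK.
have S0 : 0 <= \sum_(t < K) 2 ^+ t.+1 * g t.
  by apply: sumr_ge0 => t _; rewrite mulr_ge0 ?exprn_ge0// g0// ltnS ltnW.
rewrite big_ord_recr /=; have [lt1|ge1] := ltP (g K) 1.
  have := IH (fun t h => hg t (leqW h)) (hg K (ltnSn K) lt1) (fun t h => g0 t (leqW h)).
  move=> /le_trans -> //; rewrite ler_wpM2l// addrA lerDl.
  by rewrite mulr_ge0 ?exprn_ge0// g0.
apply: (le_trans hK); rewrite ler_wpM2l//.
have : 2 ^+ K.+1 <= 2 ^+ K.+1 * g K by rewrite ler_peMr// exprn_ge0.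
by lra.
Qed.

End Analysis.

(** Apply [x + 1 <= 2 ^ x] to the integer part [x] of [M / (p k)] and raise to the power [k]. *)
Lemma power_le_exponential k p : (0 < k -> 0 < p ->
  exists C, forall M, M.+1 ^ k <= C * 2 ^ (M %/ p))%N.
Proof.
move=> k0 p0; exists ((p * k) ^ k)%N => M.
have pk0 : (0 < p * k)%N by rewrite muln_gt0 p0.
apply: (@leq_trans ((p * k * 2 ^ (M %/ (p * k))) ^ k)%N).
  rewrite leq_exp2r// (@leq_trans (p * k * (M %/ (p * k)).+1)%N)//.
    by rewrite mulnC ltn_ceil.
  by rewrite leq_mul2l ltn_expl ?orbT.
rewrite expnMn leq_mul2l -expnM leq_exp2l// divnMA leq_divM orbT //.
Qed.

(** * The excess and its averages *)

(** The quotient is the ratio of the energy to the value [B ^ 2 / m] that it would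
have if the [B] points of the box were equidistributed modulo [m].  When the gcd
is [g], they lie in [m / g] classes only and the ratio is at least [g]. *)
Definition excess (R : realFieldType) m p (b X : 'I_p -> nat) : R :=
  (m * energy m b X)%:R / (#|box X| ^ 2)%:R -
  (gcdn m (\big[gcdn/0%N]_i b i))%:R.

Section Excess.
Variables (R : realFieldType) (m p : nat) (X : 'I_p -> nat).
Hypotheses (m_gt0 : (0 < m)%N) (X_gt0 : forall i, (0 < X i)%N).

Lemma box_gt0 : (0 < #|box X|)%N.
Proof. by rewrite card_box prodn_gt0. Qed.

Lemma sqr_box_gt0 : 0 < (#|box X| ^ 2)%:R :> R.
Proof. by rewrite ltr0n expn_gt0 box_gt0. Qed.

Lemma excess_ge0 (b : 'I_p -> nat) : 0 <= excess R m b X.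
Proof.
rewrite subr_ge0 ler_pdivlMr ?sqr_box_gt0// -natrM ler_nat.
rewrite (leq_trans (leq_mul (leqnn _) (card_box_energy b X m_gt0)))//.
by rewrite mulnA leq_mul2r mulnC card_attained ?orbT.
Qed.

Lemma excess_lt1 (b : 'I_p -> nat) : gcdn m (\big[gcdn/0%N]_i b i) = 1%N ->
  excess R m b X < 1 -> (m < 2 * #|attained m b X|)%N.
Proof.
move=> g1; rewrite /excess g1 ltrBlDr ltr_pdivrMr ?sqr_box_gt0//.
rewrite -[1 + 1]/(2%:R) -natrM ltr_nat => h.
have e0 : (0 < energy m b X)%N.
  have := card_box_energy b X m_gt0; rewrite lt0n; case: eqP => // ->.
  by rewrite muln0 leqNgt expn_gt0 box_gt0.
rewrite -(ltn_pmul2r e0) -mulnA (leq_trans h)// leq_mul2l.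
by rewrite card_box_energy.
Qed.

Lemma excess_mod (b c : 'I_p -> nat) : (forall i, b i = c i %[mod m]) ->
  excess R m b X = excess R m c X.
Proof.
move=> bc; rewrite /excess !gcd_sum_totient//.
have -> : energy m b X = energy m c X.
  apply: eq_bigr => x _; apply: eq_bigr => y _.
  have h z : dot b z = dot c z %[mod m].
    rewrite /dot -modn_summ -[in RHS]modn_summ; congr (_ %% _)%N.
    by apply: eq_bigr => i _; rewrite -modnMml bc modnMml.
  by rewrite !h.
congr (_ - _%:R); apply: eq_bigr => d dm; congr muln; apply: eq_bigr => i _.
by rewrite /dvdn -(modn_dvdm (b i) dm) bc modn_dvdm.
Qed.

(** The totient expansions of the energy and of the gcd are compared term by term:
a side of length [X] contains at most [X * (X / d + 1)] pairs congruent modulo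
[d]. *)
Lemma sum_excess_le :
  \sum_(b : {ffun 'I_p -> 'I_m}) excess R m (vec b) X <=
  m%:R ^+ p * \sum_(d < m.+1 | (d %| m)%N) (totient d)%:R *
    (\prod_i (d%:R^-1 + (X i)%:R^-1) - d%:R^-1 ^+ p).
Proof.
rewrite sumrB -mulr_suml -!natr_sum sum_gcd// -big_distrr natr_sum /=.
under [X in _ <= _ * X]eq_bigr do rewrite mulrBr.
rewrite sumrB mulrBr; apply: lerB.
  rewrite ler_pdivrMr ?sqr_box_gt0//.
  have := sum_energy_le X m_gt0; rewrite mulnC -(ler_nat R) => /le_trans -> //.
  rewrite natrM natrX -mulrA ler_wpM2l ?exprn_ge0// natr_sum mulr_suml.
  apply: ler_sum => d dm; rewrite natrM -mulrA ler_wpM2l//.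
  rewrite card_box natrX !natr_prod -prodrXl -big_split /=.
  apply: ler_prod => i _; rewrite ler0n /=.
  have d0 : (0 < d)%N by rewrite lt0n; apply: contraTneq dm => ->; rewrite dvd0n -lt0n.
  have Xi0 : 0 < (X i)%:R :> R by rewrite ltr0n.
  have dR0 : 0 < d%:R :> R by rewrite ltr0n.
  have -> : (d%:R^-1 + (X i)%:R^-1) * (X i)%:R ^+ 2 =
      (X i * (X i + d))%:R / d%:R :> R.
    by rewrite natrM natrD; field; rewrite !gt_eqF.
  rewrite ler_pdivlMr// -natrM ler_nat big_distrl /= -[X in (_ <= X * _)%N]card_ord.
  rewrite -sum_nat_const; apply: leq_sum => k _.
  have := @count_mod_le 0 (X i) d k d0; rewrite add0n big_mkord.
  by under eq_bigr do rewrite eq_sym.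
rewrite mulr_sumr; apply: ler_sum => d dm.
have d0 : (0 < d)%N by rewrite lt0n; apply: contraTneq dm => ->; rewrite dvd0n -lt0n.
rewrite natrM mulrCA ler_wpM2l// natrX -exprMn lerXn2r ?nnegrE ?mulr_ge0 ?invr_ge0//.
rewrite ler_pdivrMr ?ltr0n// -natrM ler_nat.
by rewrite divnK.
Qed.

End Excess.

Definition in_window p T (A : 'I_p -> nat) (b : {ffun 'I_p -> 'I_T}) :=
  [forall i, A i <= b i < 2 * A i]%N.

Section Windows.
Variables (R : realFieldType) (p : nat) (X : 'I_p -> nat).
Hypothesis (X_gt0 : forall i, (0 < X i)%N).
Variables (T : nat) (A : 'I_p -> nat).

(** The coefficient of [totient d] in the bound for the sum of the excesses. *)
Definition divisor_weight (d : nat) : R :=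
  \prod_i (d%:R^-1 + (X i)%:R^-1) - d%:R^-1 ^+ p.

Lemma divisor_weight_ge0 d : 0 <= divisor_weight d.
Proof.
rewrite subr_ge0 -[X in _ ^+ X]card_ord -prodr_const; apply: ler_prod => i _.
by rewrite invr_ge0 ler0n lerDl invr_ge0 ler0n.
Qed.

(** The excess depends only on [b] modulo [m], and each residue vector is hit by at
most [prod_i (3 * A i / m)] vectors of the window. *)
Lemma sum_excess_window m : (0 < m)%N -> (forall i, m <= 2 * A i)%N ->
  \sum_(b | in_window (T := T) A b) excess R m (vec b) X <=
  (\prod_i (3 * A i))%:R *
  \sum_(d < m.+1 | (d %| m)%N) (totient d)%:R * divisor_weight d.
Proof.
move=> m0 mA.
pose red (b : {ffun 'I_p -> 'I_T}) : {ffun 'I_p -> 'I_m} :=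
  [ffun i => Ordinal (ltn_pmod (b i) m0)].
have mp0 : 0 < m%:R ^+ p :> R by rewrite exprn_gt0// ltr0n.
rewrite (partition_big red xpredT)//=.
apply: (@le_trans _ _ (\sum_(c : {ffun 'I_p -> 'I_m})
    (\prod_i (3 * A i))%:R / m%:R ^+ p * excess R m (vec c) X)).
  apply: ler_sum => c _.
  apply: (@le_trans _ _ (\sum_(b | in_window A b && (red b == c)) excess R m (vec c) X)).
    apply: ler_sum => b /andP[_ /eqP <-]; rewrite le_eqVlt; apply/orP; left; apply/eqP.
    by apply: excess_mod => // i; rewrite ffunE modn_mod.
  rewrite sumr_const -[leLHS]mulr_natl ler_wpM2r ?excess_ge0//.
  rewrite ler_pdivlMr// -natrX -natrM ler_nat.
  rewrite -[X in (_ * _ ^ X)%N]card_ord -prod_nat_const -sum1_card.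
  rewrite (eq_bigl (fun b => b \in family (fun i (k : 'I_T) =>
     (A i <= k < 2 * A i)%N && (k == c i %[mod m])%N))); last first.
    move=> b; apply/andP/familyP.
      move=> [/forallP hA /eqP <-] i; rewrite unfold_in hA ffunE /=.
      by rewrite modn_mod eqxx.
    move=> h; split; first by apply/forallP => i; case/andP: (h i).
    apply/eqP/ffunP => i; rewrite ffunE; apply/val_inj => /=.
    by case/andP: (h i) => _ /eqP ->; rewrite modn_small.
  rewrite (eq_bigr (fun b : {ffun 'I_p -> 'I_T} => \prod_(i < p) 1)%N); last first.
    by move=> b _; rewrite big1.
  rewrite -(bigA_distr_big_dep (fun i (k : 'I_T) =>
     (A i <= k < 2 * A i)%N && (k == c i %[mod m])%N) (fun _ _ => 1%N)) -big_split /=.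
  by apply: leq_prod => i _; exact: card_mod_window_le.
rewrite -mulr_sumr -mulrA ler_wpM2l//.
by rewrite ler_pdivrMl// sum_excess_le.
Qed.

(** Summing over [m] as well replaces the divisors of a given [m], whose number is
irregular, by all integers [d < 2 ^ e.+1]. *)
Lemma sum_excess_box e : (forall i, 2 ^ e <= A i)%N ->
  \sum_(m < T | (2 ^ e <= m < 2 * 2 ^ e)%N)
    \sum_(b | in_window (T := T) A b) excess R m (vec b) X <=
  (\prod_i (3 * A i))%:R * (2 ^+ e.+1 *
    (2 ^+ e.+1 * \prod_i (X i)%:R^-1 + 3 ^+ p * (e.+1%:R * \sum_i (X i)%:R^-1))).
Proof.
move=> eA.
apply: (@le_trans _ _ (\sum_(m < T | (2 ^ e <= m < 2 * 2 ^ e)%N)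
   (\prod_i (3 * A i))%:R *
   \sum_(d < m.+1 | (d %| m)%N) (totient d)%:R * divisor_weight d)).
  apply: ler_sum => m /andP[m1 m2]; apply: sum_excess_window.
    by rewrite (leq_trans _ m1)// expn_gt0.
  by move=> i; rewrite (leq_trans (ltnW m2))// leq_mul2l /= eA.
rewrite -mulr_sumr ler_wpM2l//.
set S := fun m : nat => \sum_(d < m.+1 | (d %| m)%N) (totient d)%:R * divisor_weight d.
have S0 m : 0 <= S m.
  by apply: sumr_ge0 => d _; rewrite mulr_ge0// divisor_weight_ge0.
apply: (@le_trans _ _ (\sum_(1 <= m < 2 ^ e.+1) S m)).
  rewrite -(big_mkord (fun m => 2 ^ e <= m < 2 * 2 ^ e)%N S).
  have hT : (T <= maxn T (2 ^ e.+1))%N by rewrite leq_maxl.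
  have hT' : (2 ^ e.+1 <= maxn T (2 ^ e.+1))%N by rewrite leq_maxr.
  rewrite (big_nat_widen _ _ _ _ _ hT) (@big_nat_widenl _ _ _ 1 0)//.
  rewrite (big_nat_widen _ _ _ _ _ hT') [leLHS]big_mkcond [leRHS]big_mkcond /=.
  apply: ler_sum => m _; case: ifP => [/andP[/andP[m1 m2] _]|_]; last by case: ifP.
  by rewrite (leq_trans _ m1) ?expn_gt0// expnS m2.
apply: (le_trans (sum_divisors_le _ (fun d _ => divisor_weight_ge0 d))).
rewrite natrX ler_wpM2l ?exprn_ge0//.
apply: (@le_trans _ _ (\sum_(1 <= d < 2 ^ e.+1)
   (\prod_i (X i)%:R^-1 + 3 ^+ p * (d%:R^-1 * \sum_i (X i)%:R^-1)))).
  rewrite big_nat_cond [leRHS]big_nat_cond; apply: ler_sum => d /andP[/andP[d1 _] _].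
  apply: prod_addl_le => [|i].
    by rewrite invr_ge0 ler0n invf_le1 ?ltr0n ?ler1n.
  by rewrite invr_ge0 ler0n invf_le1 ?ltr0n ?ler1n ?X_gt0.
have inv0 i : 0 <= (X i)%:R^-1 :> R by rewrite invr_ge0.
rewrite big_split /= lerD//.
  rewrite sumr_const_nat -[leLHS]mulr_natl ler_wpM2r//; first exact: prodr_ge0.
  by rewrite -natrX ler_nat leq_subr.
rewrite -mulr_sumr ler_wpM2l ?exprn_ge0// -mulr_suml ler_wpM2r//.
  exact: sumr_ge0.
exact: harmonic_dyadic.
Qed.

End Windows.

(** * Frobenius numbers *)

Local Open Scope nat_scope.

Section Frobenius.
Variables (p : nat) (a : 'I_p.+1 -> nat) (j : 'I_p.+1).
Hypothesis prim_a : primitive_vec a.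
Let m := a j.
Let b i := a (lift j i).

Lemma primitive_gt0 i : 0 < a i.
Proof. by case/andP: prim_a => /forallP. Qed.

Lemma primitive_gcd : gcdn m (\big[gcdn/0]_i b i) = 1.
Proof. by case/andP: prim_a => _ /eqP <-; rewrite (bigD1_ord j). Qed.

(** A number [N > b . Y] congruent to [b . x] modulo [m], with [x <= Y], is
[b . x + q m] for some [q >= 0]. *)
Lemma frobenius_le (Y : 'I_p -> nat) :
  (forall r, exists x, (forall i, x i <= Y i) /\ dot b x = r %[mod m]) ->
  (frobenius a <= (dot b Y)%:Z)%R.
Proof.
move=> cov; have [nrep _] := frobeniusP prim_a.
rewrite leNgt; apply/negP; case: (frobenius a) nrep => // N nrep; rewrite ltz_nat => ltN.
have [x [xY hx]] := cov N.
have lex : dot b x <= N.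
  by rewrite (leq_trans _ (ltnW ltN))// leq_sum// => i _; rewrite leq_mul2l xY orbT.
have [q hq] : exists q, N = dot b x + m * q.
  have : m %| N - dot b x by rewrite -eqn_mod_dvd// hx.
  by move=> /dvdnP[q hq]; exists q; rewrite mulnC -hq subnKC.
apply: (nrep (fun k => if unlift j k is Some i then x i else q)).
rewrite hq /dot (bigD1_ord j)//= unlift_none addnC; congr (Posz (_ + _)).
by apply: eq_bigr => i _; rewrite liftK.
Qed.

Lemma frobenius_le_trivial : (frobenius a <= (dot b (fun=> m))%:Z)%R.
Proof.
apply: frobenius_le => r.
have m0 : 0 < m by exact: primitive_gt0.
have [w hw] := bezout_mod b m0; rewrite primitive_gcd in hw.
exists (fun i => (r * w i) %% m); split=> [i|]; first by rewrite ltnW// ltn_pmod.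
have -> : dot b (fun i => (r * w i) %% m) = r * dot w b %[mod m].
  rewrite /dot big_distrr -modn_summ -[in RHS]modn_summ; congr (_ %% _).
  by apply: eq_bigr => i _; rewrite modnMmr mulnCA [b i * _]mulnC.
by rewrite -modnMmr hw modnMmr muln1.
Qed.

Lemma frobenius_le_excess (R : realFieldType) (X : 'I_p -> nat) :
  (forall i, 0 < X i) -> (excess R m b X < 1)%R ->
  (frobenius a <= (dot b (fun i => 2 * (X i).-1)%N)%:Z)%R.
Proof.
move=> X0 ex1; apply: frobenius_le => r.
have m0 : 0 < m by exact: primitive_gt0.
have [x [y [hx hy hr]]] := attained_add m0 (excess_lt1 m0 X0 primitive_gcd ex1) r.
exists (fun i => x i + y i); split.
  move: hx hy; rewrite !inE => /forallP hx /forallP hy i /=.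
  by have hx_i := hx i; have hy_i := hy i; have X_i := X0 i;
    rewrite mul2n -addnn leq_add// -ltnS prednK.
by rewrite -hr /dot -big_split; congr (_ %% _); apply: eq_bigr => i _; rewrite mulnDr.
Qed.

End Frobenius.

Definition dyadic_class n (a : 'I_n -> nat) (e : 'I_n -> nat) :=
  [forall i, 2 ^ e i <= a i < 2 * 2 ^ e i].

Section DyadicClass.
Variables (p : nat) (e : 'I_p.+1 -> nat) (j : 'I_p.+1).
Hypothesis p_gt0 : 0 < p.
Let f := (\sum_i e i) %/ p.

(** A power of 2 close to [2 ^ t * 2 ^ f / a_i].  Truncated subtraction makes it equal
to 1 when that quotient is smaller; the corresponding [x_i] is then 0, hence costs
nothing in the bound for the Frobenius number. *)
Definition side t (i : 'I_p) := 2 ^ (t + f - e (lift j i)).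

Lemma side_gt0 t i : 0 < side t i.
Proof. by rewrite expn_gt0. Qed.

Variable a : 'I_p.+1 -> nat.
Hypotheses (prim_a : primitive_vec a) (a_e : dyadic_class a e).
Let m := a j.
Let b i := a (lift j i).

Lemma frobenius_le_side (R : realFieldType) t :
  (excess R m b (side t) < 1)%R ->
  (frobenius a <= (4 * p * 2 ^ f * 2 ^ t)%N%:Z)%R.
Proof.
move=> ex1; apply: le_trans (frobenius_le_excess prim_a (side_gt0 t) ex1) _.
rewrite lez_nat.
have -> : 4 * p * 2 ^ f * 2 ^ t = \sum_(i < p) 4 * 2 ^ (t + f).
  by rewrite sum_nat_const card_ord expnD; lia.
apply: leq_sum => i _; rewrite -/(b i) /side.
have /andP[_ hb] := forallP a_e (lift j i); rewrite -/(b i) in hb.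
have [le|/ltnW/eqP ->] := leqP (e (lift j i)) (t + f); last by rewrite muln0.
rewrite -[X in _ <= 4 * 2 ^ X](subnKC le) expnD.
have ub : b i * (2 ^ (t + f - e (lift j i))).-1 <= 2 * 2 ^ e (lift j i) * 2 ^ (t + f - e (lift j i)).
  by rewrite leq_mul ?leq_pred// ltnW.
by lia.
Qed.

(** A polynomial bound valid for all primitive vectors, to stop the layers after
[O(log T)] steps. *)
Lemma frobenius_le_crude L : (forall i, a i < 2 ^ L) ->
  (frobenius a <= (4 * p * 2 ^ f * 2 ^ (2 * L))%N%:Z)%R.
Proof.
move=> aL; apply: le_trans (frobenius_le_trivial j prim_a) _; rewrite lez_nat.
apply: (@leq_trans (\sum_(i < p) 2 ^ (2 * L))).
  by apply: leq_sum => i _; rewrite mul2n -addnn expnD leq_mul// ltnW.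
rewrite sum_nat_const card_ord leq_mul2r; apply/orP; right.
by have := expn_gt0 2 f; move: (2 ^ f) => [|?] //= _; lia.
Qed.

Local Open Scope ring_scope.

Lemma frobenius_le_sum_excess (R : realFieldType) L : (forall i, a i < 2 ^ L)%N ->
  (frobenius a)%:~R <= (4 * p * 2 ^ f)%:R *
    (1 + \sum_(t < 2 * L) 2 ^+ t.+1 * excess R m b (side t)).
Proof.
move=> aL; apply: (layer_cake (g := fun t => excess R m b (side t))) => //.
- move=> t _ /frobenius_le_side h; rewrite -natrX -natrM -[_%:R]/((Posz _)%:~R).
  by rewrite ler_int.
- rewrite -natrX -natrM -[_%:R]/((Posz _)%:~R) ler_int; exact: frobenius_le_crude.
- move=> t _; apply: excess_ge0; [exact: primitive_gt0 | exact: side_gt0].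
Qed.

End DyadicClass.

(** * The sum over one dyadic class *)

Local Open Scope ring_scope.

(** Separating the coordinate [j] from the others identifies the class with the
product of a dyadic interval for [m] and a window for [b]. *)
Lemma sum_excess_class (R : realFieldType) p T (e : 'I_p.+1 -> nat) j (X : 'I_p -> nat) :
  (forall i, 0 < X i)%N -> (forall i, e j <= e i)%N ->
  \sum_(a : {ffun 'I_p.+1 -> 'I_T} | dyadic_class (vec a) e)
     excess R (a j) (fun i => a (lift j i)) X <=
  (\prod_i (3 * 2 ^ e (lift j i)))%:R * (2 ^+ (e j).+1 *
    (2 ^+ (e j).+1 * \prod_i (X i)%:R^-1 +
     3 ^+ p * ((e j).+1%:R * \sum_i (X i)%:R^-1))).
Proof.
move=> X0 ej.
have ejl i : (2 ^ e j <= 2 ^ e (lift j i))%N by rewrite leq_exp2l.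
apply: le_trans (sum_excess_box R X0 T ejl).
pose join (mb : 'I_T * {ffun 'I_p -> 'I_T}) : {ffun 'I_p.+1 -> 'I_T} :=
  [ffun k => if unlift j k is Some i then mb.2 i else mb.1].
pose split (a : {ffun 'I_p.+1 -> 'I_T}) : 'I_T * {ffun 'I_p -> 'I_T} :=
  (a j, [ffun i => a (lift j i)]).
have joinK : cancel join split.
  move=> [m b]; rewrite /split ffunE unlift_none; congr pair.
  by apply/ffunP => i; rewrite !ffunE liftK.
have splitK : cancel split join.
  move=> a; apply/ffunP => k; rewrite ffunE.
  by case: unliftP => [i|] -> //=; rewrite ffunE.
rewrite (reindex join); last by exists split => ? _; [exact: joinK | exact: splitK].
rewrite pair_big_dep le_eqVlt; apply/orP; left; apply/eqP => /=; apply: eq_big => [[m b]|[m b] _].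
  apply/forallP/andP => /= [h|[hm /forallP hb] i].
    split; first by have := h j; rewrite ffunE unlift_none.
    by apply/forallP => i; have := h (lift j i); rewrite ffunE liftK.
  by rewrite ffunE; case: unliftP => [k|] -> //=.
rewrite ffunE unlift_none /=; congr excess.
by apply/funext => i; rewrite ffunE liftK.
Qed.

Section ClassSum.
Variables (R : realType) (p : nat).
Hypothesis p_ge2 : (2 <= p)%N.
Variables (e : 'I_p.+1 -> nat) (M : nat).
Hypothesis e_le : forall i, (e i <= M)%N.
Let E := (\sum_i e i)%N.
Let f := (E %/ p)%N.

Let p_gt0 : (0 < p)%N. Proof. exact: leq_trans p_ge2. Qed.

(** The choice of [f] gives [2 ^ E <= 2 ^ p * (2 ^ f) ^ p], so that the product of the
inverse sides is at most [2 ^ p / 2 ^ (p t)] after multiplication by [2 ^ e j]; the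
inequality [p >= 2] is used to replace [2 ^ (p t)] by [4 ^ t]. *)
Lemma sum_excess_side T j t : (forall i, e j <= e i)%N ->
  \sum_(a : {ffun 'I_p.+1 -> 'I_T} | dyadic_class (vec a) e)
     excess R (a j) (fun i => a (lift j i)) (side e j t) <=
  2 * 3 ^+ p * 2 ^+ E * (2 ^+ p.+1 / 4 ^+ t +
     3 ^+ p * (M.+1%:R * (p%:R * (2 ^+ M / (2 ^+ t * 2 ^+ f))))).
Proof.
move=> ej; apply: le_trans (sum_excess_class R T (side_gt0 e j t) ej) _.
have x20 k : 0 < 2 ^+ k :> R by rewrite exprn_gt0.
have side_inv i : (side e j t i)%:R^-1 <= 2 ^+ e (lift j i) / (2 ^+ t * 2 ^+ f) :> R.
  rewrite -div1r ler_pdivrMr ?ltr0n ?side_gt0// mulrAC ler_pdivlMr ?mulr_gt0// mul1r.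
  rewrite /side natrX -!exprD ler_eXn2l ?ltr1n// -/E -/f.
  by rewrite -leq_subLR.
have E_eq : E = (e j + \sum_i e (lift j i))%N by rewrite /E (bigD1_ord j).
have prod_e : \prod_i (2 ^+ e (lift j i)) = 2 ^+ (\sum_i e (lift j i))%N :> R.
  by rewrite prodrXr.
have sides : 2 ^+ e j * \prod_i (side e j t i)%:R^-1 <= 2 ^+ p / 4 ^+ t :> R.
  apply: (@le_trans _ _ (2 ^+ e j * \prod_(i < p) (2 ^+ e (lift j i) / (2 ^+ t * 2 ^+ f)))).
    rewrite ler_pM2l//; apply: ler_prod => i _; rewrite side_inv invr_ge0 ler0n //.
  rewrite big_split /= prod_e mulrA [2 ^+ e j * _](_ : _ = 2 ^+ E); last by rewrite E_eq exprD.
  rewrite prodr_const card_ord exprVn.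
  rewrite ler_pdivrMr ?exprn_gt0 ?mulr_gt0// mulrAC ler_pdivlMr ?exprn_gt0//.
  have -> : 4 = 2 ^+ 2 :> R by rewrite -natrX.
  rewrite -!exprD -!exprM -!exprD ler_eXn2l ?ltr1n//.
  have := divn_eq E p; rewrite -/f; have := ltn_pmod E p_gt0; nia.
have Eprod : (\prod_i (3 * 2 ^ e (lift j i)))%:R * 2 ^+ (e j).+1 =
    2 * 3 ^+ p * 2 ^+ E :> R.
  rewrite big_split /= prod_nat_const card_ord natrM natrX natr_prod.
  under eq_bigr do rewrite natrX.
  by rewrite prod_e E_eq exprS exprD; ring.
rewrite mulrA Eprod ler_pM2l ?mulr_gt0 ?exprn_gt0//.
rewrite !exprS -!mulrA; apply: lerD; first by rewrite ler_pM2l.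
rewrite ler_pM2l ?exprn_gt0//; apply: ler_pM => //.
- by apply: sumr_ge0 => i _; rewrite invr_ge0.
- by rewrite ler_nat ltnS.
rewrite mulr_natl -[X in _ *+ X]card_ord -sumr_const.
apply: ler_sum => i _; apply: le_trans (side_inv i) _.
by rewrite ler_pM2r ?invr_gt0 ?mulr_gt0// ler_eXn2l ?ltr1n.
Qed.

(** The quantity [E - E / p] increases with [E], which is at most [(p + 1) M]. *)
Lemma volume_diameter_le :
  2 ^+ E * 2 ^+ M / 2 ^+ f <= 2 ^+ (p.+1 * M) / 2 ^+ (M %/ p) :> R.
Proof.
rewrite ler_pdivrMr ?exprn_gt0// mulrAC ler_pdivlMr ?exprn_gt0//.
rewrite -!exprD ler_eXn2l ?ltr1n//.
have EM : (E <= p.+1 * M)%N.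
  rewrite -[X in (_ <= X * _)%N]card_ord -sum_nat_const.
  by apply: leq_sum.
suff h : ((p.+1 * M) %/ p <= f + (p.+1 * M - E))%N.
  by move: h; rewrite (_ : (p.+1 * M = M * p + M)%N) ?divnMDl//; lia.
rewrite -ltnS ltn_divLR// {1}(_ : (p.+1 * M = E + (p.+1 * M - E))%N); last by rewrite subnKC.
have := divn_eq E p; rewrite -/f; have := ltn_pmod E p_gt0.
move: (p.+1 * M - E)%N => d; nia.
Qed.

(** The decay [4 ^ (- t)] of the main term beats the weights [2 ^ t].  In the error
term the weights cancel the decay [2 ^ (- t)], which costs a factor equal to the
number of layers. *)
Lemma sum_layers T j : (forall i, e j <= e i)%N ->
  \sum_(a : {ffun 'I_p.+1 -> 'I_T} | dyadic_class (vec a) e)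
    \sum_(t < 2 * M.+1) 2 ^+ t.+1 *
      excess R (a j) (fun i => a (lift j i)) (side e j t) <=
  8 * 3 ^+ p * (2 ^+ p.+1 * 2 ^+ E +
     3 ^+ p * p%:R * (M.+1%:R ^+ 2 * (2 ^+ (p.+1 * M) / 2 ^+ (M %/ p)))).
Proof.
move=> ej; rewrite exchange_big /=.
under eq_bigr do rewrite -mulr_sumr.
pose u : R := 2 ^+ M / 2 ^+ f.
apply: (@le_trans _ _ (\sum_(t < 2 * M.+1) (2 * 3 ^+ p * 2 ^+ E) *
   (2 * 2 ^+ p.+1 * 2^-1 ^+ t + 2 * 3 ^+ p * M.+1%:R * p%:R * u))).
  apply: ler_sum => t _.
  apply: (le_trans (ler_wpM2l _ (sum_excess_side T t ej))); first by rewrite exprn_ge0.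
  rewrite le_eqVlt; apply/orP; left; apply/eqP.
  have -> : 4 ^+ t = 2 ^+ t * 2 ^+ t :> R by rewrite -exprMn -natrM.
  rewrite /u exprS exprVn; field.
  by rewrite !expf_neq0 ?pnatr_eq0.
rewrite -mulr_sumr big_split /= -mulr_sumr sumr_const card_ord -[_ *+ (2 * _)]mulr_natl natrM.
(* The error term: diameter of the class times its volume over [2 ^ f]. *)
have V : 2 ^+ E * u <= 2 ^+ (p.+1 * M) / 2 ^+ (M %/ p).
  by rewrite /u mulrA volume_diameter_le.
have G2 := geometric_half_le R (2 * M.+1).
set S := \sum_(t < _) _ in G2 *.
set W := 2 ^+ (p.+1 * M) / _ in V *.
have h1 : 4 * 3 ^+ p * 2 ^+ p.+1 * 2 ^+ E * S <= 4 * 3 ^+ p * 2 ^+ p.+1 * 2 ^+ E * 2.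
  by rewrite ler_wpM2l// !mulr_ge0 ?exprn_ge0.
have h2 : 8 * 3 ^+ p * (3 ^+ p * p%:R * M.+1%:R ^+ 2) * (2 ^+ E * u) <=
          8 * 3 ^+ p * (3 ^+ p * p%:R * M.+1%:R ^+ 2) * W.
  by rewrite ler_wpM2l// !mulr_ge0 ?exprn_ge0.
set X := 3 ^+ p in h1 h2 *; set Y := 2 ^+ p.+1 in h1 *; set Z := 2 ^+ E in h1 h2 *.
have -> : 2 * X * Z * (2 * Y * S + 2 * M.+1%:R * (2 * X * M.+1%:R * p%:R * u)) =
   4 * X * Y * Z * S + 8 * X * (X * p%:R * M.+1%:R ^+ 2) * (Z * u) by ring.
have -> : 8 * X * (Y * Z + X * p%:R * (M.+1%:R ^+ 2 * W)) =
   4 * X * Y * Z * 2 + 8 * X * (X * p%:R * M.+1%:R ^+ 2) * W by ring.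
exact: lerD.
Qed.

Lemma root_volume_le (a : 'I_p.+1 -> nat) : dyadic_class a e ->
  2 ^+ f <= (\prod_i (a i)%:R) `^ (p.+1%:R - 1)^-1 :> R.
Proof.
move=> /forallP ae; rewrite -[p.+1%:R]natr1 addrK.
have hp : p%:R != 0 :> R by rewrite pnatr_eq0 -lt0n.
have -> : 2 ^+ f = (2 ^+ (f * p)) `^ p%:R^-1 :> R.
  by rewrite exprM -[2 ^+ f ^+ p]powR_mulrn ?exprn_ge0// -powRrM mulfV// powRr1// exprn_ge0.
rewrite ge0_ler_powR ?invr_ge0 ?nnegrE ?exprn_ge0 ?prodr_ge0//.
apply: (@le_trans _ _ (2 ^+ E)); first by rewrite ler_eXn2l ?ltr1n// leq_divM.
rewrite -prodrXr; apply: ler_prod => i _; rewrite exprn_ge0//=.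
by rewrite -natrX ler_nat; case/andP: (ae i).
Qed.

End ClassSum.

(** * Primitive vectors have positive density *)

Local Open Scope nat_scope.

(** A positive vector that is not primitive has all its entries divisible by its gcd
[d >= 2], and there are [(T / d) ^ n] positive vectors with entries divisible by
[d]. *)
Lemma positive_le_card_G n T : 0 < n ->
  T ^ n <= #|G n T| + \sum_(2 <= d < T.+1) (T %/ d) ^ n.
Proof.
move=> n0.
pose P (a : {ffun 'I_n -> 'I_T.+1}) := [forall i, 0 < a i].
have prodP (F : nat -> nat) :
    \sum_(a | P a) \prod_i F (a i) = (\sum_(1 <= k < T.+1) F k) ^ n.
  rewrite -[X in _ ^ X]card_ord -prod_nat_const.
  transitivity (\prod_(i < n) \sum_(k < T.+1 | 0 < k) F k).
    rewrite (bigA_distr_big_dep (fun i (k : 'I_T.+1) => 0 < k) (fun i k => F k)).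
    by apply: eq_bigl => a; apply/forallP/familyP.
  apply: eq_bigr => i _.
  rewrite -(big_mkord (fun k => 0 < k) F) [RHS](@big_nat_widenl _ _ _ 1 0)//.
have -> : T ^ n = \sum_(a | P a) 1.
  rewrite -[T in LHS](_ : \sum_(1 <= k < T.+1) 1 = T); last first.
    by rewrite sum_nat_const_nat muln1 subn1.
  by rewrite -(prodP (fun=> 1)); apply: eq_bigr => a _; rewrite big1.
have -> : \sum_(2 <= d < T.+1) (T %/ d) ^ n =
    \sum_(a | P a) \sum_(2 <= d < T.+1) \prod_i (d %| a i).
  rewrite exchange_big /=; apply: eq_bigr => d _.
  by rewrite (prodP (fun k => (d %| k) : nat)) divn_count_dvd.
have -> : #|G n T| = \sum_(a | P a) (primitive_vec (vec a) : nat).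
  rewrite -sum1_card big_mkcond [RHS]big_mkcond; apply: eq_bigr => a _.
  by rewrite inE /primitive_vec -/(P a); case: (P a).
rewrite -big_split; apply: leq_sum => a Pa /=.
rewrite /primitive_vec -/(P a) Pa /=; case: eqP => // /eqP g1.
set g := \big[gcdn/0]_(i < n) a i in g1.
have i0 : 'I_n by exact: Ordinal n0.
have gdv i : g %| a i by exact: (biggcdn_inf i).
have ai0 : 0 < a i0 by move: Pa => /forallP.
have gT : g < T.+1 by rewrite (leq_ltn_trans (dvdn_leq ai0 (gdv i0))).
have g2 : 2 <= g.
  by rewrite ltn_neqAle eq_sym g1 (dvdn_gt0 ai0 (gdv i0)).
rewrite (bigD1_seq g) ?mem_index_iota ?g2 ?gT ?iota_uniq//= prod_bool_forall.
by rewrite (introT forallP) //.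
Qed.

Local Open Scope ring_scope.

(** Telescoping: [1 / d ^ 3 <= (1 / (d - 1) - 1 / d) / 2]. *)
Lemma sum_inv_cube_le (R : realFieldType) T :
  \sum_(2 <= d < T.+1) (d%:R ^+ 3)^-1 <= 2^-1 :> R.
Proof.
apply: (@le_trans _ _ (\sum_(2 <= d < T.+1) ((- (2 * d%:R)^-1) - (- (2 * d.-1%:R)^-1)))).
  rewrite big_nat_cond [leRHS]big_nat_cond; apply: ler_sum => d /andP[/andP[d2 _] _].
  case: d d2 => // -[//|d] _ /=; rewrite -[d.+2%:R]natr1.
  have x0 : (0 < d.+1%:R :> R)%R by rewrite ltr0n.
  move: (d.+1%:R : R) x0 => x x0.
  have x1 : x != 0 by rewrite gt_eqF.
  have x2 : x + 1 != 0 by rewrite gt_eqF// ltr_wpDr.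
  rewrite -subr_ge0; have -> : (- (2 * (x + 1))^-1 - - (2 * x)^-1 - ((x + 1) ^+ 3)^-1 =
    (x ^+ 2 + 1) / (2 * x * (x + 1) ^+ 3))%R by field; rewrite x1 x2.
  rewrite mulr_ge0 ?invr_ge0//; first by nra.
  by rewrite !mulr_ge0 ?exprn_ge0//; lra.
have [T1|T2] := ltnP T 1; first by rewrite big_geq ?invr_ge0// ltnS ltnW.
rewrite -(prednK T2) big_add1 /= telescope_sumr// /= mulr1 opprK.
by rewrite gerDr oppr_le0 invr_ge0 mulr_ge0.
Qed.

Lemma card_G_ge n T : (3 <= n -> T ^ n <= 2 * #|G n T|)%N.
Proof.
move=> n3; have := positive_le_card_G T (ltn_trans (isT : (0 < 2)%N) n3).
have : (2 * \sum_(2 <= d < T.+1) (T %/ d) ^ n <= T ^ n)%N; last by lia.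
rewrite -(ler_nat rat) natrM natr_sum natrX mulrC -ler_pdivlMr//.
apply: le_trans (ler_wpM2l _ (sum_inv_cube_le rat T)); last by rewrite exprn_ge0.
rewrite mulr_sumr big_nat_cond [leRHS]big_nat_cond.
apply: ler_sum => d /andP[/andP[d2 _] _].
have d0 : (0 < d%:R :> rat)%R by rewrite ltr0n ltnW.
rewrite natrX ler_pdivlMr ?exprn_gt0//.
apply: (@le_trans _ _ ((T %/ d)%:R ^+ n * d%:R ^+ n)%R).
  by rewrite ler_wpM2l ?exprn_ge0// ler_weXn2l// ler1n ltnW.
by rewrite -exprMn -natrM lerXn2r ?nnegrE// ler_nat leq_divM.
Qed.

(** * The upper bound *)

(** Indexes the dyadic class of a vector by a finite type. *)
Definition log_vec n T (a : {ffun 'I_n -> 'I_T.+1}) :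
    {ffun 'I_n -> 'I_(trunc_log 2 T).+1} :=
  [ffun i => inord (trunc_log 2 (a i))].

Lemma log_vecE n T (a : {ffun 'I_n -> 'I_T.+1}) i :
  log_vec a i = trunc_log 2 (a i) :> nat.
Proof. by rewrite ffunE inordK// ltnS leq_trunc_log// -ltnS. Qed.

Lemma dyadic_class_log_vec n T (a : {ffun 'I_n -> 'I_T.+1}) :
  a \in G n T -> dyadic_class (vec a) (vec (log_vec a)).
Proof.
rewrite inE => /andP[/forallP a0 _]; apply/forallP => i.
by rewrite log_vecE -expnS; exact: trunc_log_bounds.
Qed.

Section Total.
Variables (R : realType) (p : nat).
Hypothesis p_ge2 : (2 <= p)%N.
Local Notation n := p.+1.
Let p_gt0 : (0 < p)%N. Proof. exact: leq_trans p_ge2. Qed.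

(** The excesses are nonnegative for all positive vectors, so the sum over the
primitive vectors of a class can be extended to the whole class. *)
Lemma sum_class_le T (e : {ffun 'I_n -> 'I_(trunc_log 2 T).+1})
    (M := trunc_log 2 T) :
  \sum_(a in G n T | log_vec a == e) normalized_frobenius R (vec a) <=
  (4 * p)%:R * (\sum_(a in G n T | log_vec a == e) 1 +
    8 * 3 ^+ p * (2 ^+ n * 2 ^+ (\sum_i e i)%N +
     3 ^+ p * p%:R * (M.+1%:R ^+ 2 * (2 ^+ (n * M) / 2 ^+ (M %/ p))))).
Proof.
set j := [arg min_(i < ord0) (e i : nat)]%N.
have ej i : (e j <= e i)%N by rewrite /j; case: arg_minnP => // k _; apply.
have eM i : (e i <= M)%N by rewrite -ltnS.
pose S (a : {ffun 'I_n -> 'I_T.+1}) : R := \sum_(t < 2 * M.+1) 2 ^+ t.+1 *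
      excess R (a j) (fun i => a (lift j i)) (side (vec e) j t).
have cls (a : {ffun 'I_n -> 'I_T.+1}) : (a \in G n T) && (log_vec a == e) ->
    dyadic_class (vec a) (vec e).
  by move=> /andP[aG /eqP <-]; exact: dyadic_class_log_vec.
apply: (@le_trans _ _ (\sum_(a in G n T | log_vec a == e) (4 * p)%:R * (1 + S a))).
  apply: ler_sum => a aGe; have ae := cls a aGe.
  case/andP: aGe; rewrite inE => prim_a _.
  have aL i : (a i < 2 ^ M.+1)%N.
    by rewrite (leq_ltn_trans _ (trunc_log_ltn T (ltnSn 1)))// -ltnS.
  have := frobenius_le_sum_excess j p_gt0 prim_a ae R aL.
  have := root_volume_le R p_ge2 ae.
  rewrite /normalized_frobenius -/(S a); set N := _ `^ _; set f := (_ %/ p)%N => fN.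
  have f0 : 0 < 2 ^+ f :> R by rewrite exprn_gt0.
  have N0 : 0 < N by exact: lt_le_trans fN.
  have S0 : 0 <= S a.
    apply: sumr_ge0 => t _; rewrite mulr_ge0 ?exprn_ge0//; apply: excess_ge0.
      exact: (primitive_gt0 prim_a).
    exact: side_gt0.
  rewrite ler_pdivrMr// natrM natrX => /le_trans -> //.
  by rewrite mulrAC ler_wpM2l// mulr_ge0// addr_ge0.
rewrite -mulr_sumr ler_wpM2l// big_split lerD2l.
apply: le_trans (sum_layers R p_ge2 eM T.+1 ej).
rewrite big_mkcond [leRHS]big_mkcond; apply: ler_sum => a _ /=.
case: ifP => [/cls ->//|_]; case: ifP => // /forallP ae.
apply: sumr_ge0 => t _; rewrite mulr_ge0 ?exprn_ge0//; apply: excess_ge0.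
  by case/andP: (ae j) => + _; apply: leq_trans; rewrite expn_gt0.
exact: side_gt0.
Qed.

Lemma average_frobenius_le : exists2 c : R, 0 < c &
  forall T, (0 < T)%N -> average_frobenius R n T <= c.
Proof.
(* The exponent [n + 2]: [n] for the number of classes, 2 for the number of layers
   times the harmonic sum. *)
have [C hC] := power_le_exponential (isT : (0 < n.+2)%N) p_gt0.
pose K : R := 8 * 3 ^+ p * (2 ^+ n * 2 ^+ n + 3 ^+ p * p%:R * C%:R).
have K0 : 0 <= K by rewrite !(mulr_ge0, addr_ge0, exprn_ge0).
exists ((4 * p)%:R * (1 + 2 * K)).
  by rewrite mulr_gt0 ?ltr0n ?muln_gt0 ?p_gt0// ltr_wpDr ?mulr_ge0.
move=> T T0; set M := trunc_log 2 T.
have G0 : (0 < #|G n T|)%N by exact: G_gt0.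
rewrite /average_frobenius ler_pdivrMr ?ltr0n//.
rewrite (partition_big (@log_vec n T) xpredT)//=.
apply: (le_trans (ler_sum _ (fun e _ => sum_class_le e))); rewrite /= -/M.
rewrite -mulr_sumr -[leRHS]mulrA ler_wpM2l// big_split /=.
rewrite -(partition_big (@log_vec n T) xpredT)//= sumr_const -mulr_sumr big_split /=.
rewrite -mulr_sumr sumr_const card_ffun !card_ord [leRHS]mulrDl mul1r lerD2l.
have MT : (2 ^ M <= T)%N by exact: trunc_logP.
have V : \sum_(e : {ffun 'I_n -> 'I_M.+1}) 2 ^+ (\sum_i e i)%N <= 2 ^+ n * T%:R ^+ n :> R.
  apply: (@le_trans _ _ ((\sum_(k < M.+1) 2 ^+ k) ^+ n)).
    rewrite -[X in _ ^+ X]card_ord -prodr_const bigA_distr_bigA /=.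
    by apply: ler_sum => e _; rewrite prodrXr.
  rewrite -exprMn lerXn2r ?nnegrE ?sumr_ge0 ?mulr_ge0//.
  have -> : \sum_(k < M.+1) 2 ^+ k = 2 ^+ M.+1 - 1 :> R.
    by rewrite subrX1 -[2 - 1]/(1 + 1 - 1) addrK mul1r.
  by rewrite lerBlDr -natrX -natrM natr1 ler_nat expnS; lia.
have W : M.+1%:R ^+ 2 * (2 ^+ (n * M) / 2 ^+ (M %/ p)) *+ M.+1 ^ n <= C%:R * T%:R ^+ n :> R.
  have hM : M.+1%:R ^+ p.+3 <= C%:R * 2 ^+ (M %/ p) :> R.
    by rewrite -!natrX -natrM ler_nat; exact: hC.
  have hT : 2 ^+ (n * M) <= T%:R ^+ n :> R.
    by rewrite mulnC exprM lerXn2r ?nnegrE ?exprn_ge0// -natrX ler_nat.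
  rewrite -[leLHS]mulr_natr natrX mulrA mulrAC ler_pdivrMr ?exprn_gt0//.
  have -> : M.+1%:R ^+ 2 * 2 ^+ (n * M) * M.+1%:R ^+ n =
      M.+1%:R ^+ p.+3 * 2 ^+ (n * M) :> R.
    by rewrite mulrAC -exprD.
  by rewrite [leRHS]mulrAC; apply: ler_pM => //; rewrite exprn_ge0.
have GT : T%:R ^+ n <= 2 * #|G n T|%:R :> R.
  by rewrite -natrX -natrM ler_nat card_G_ge.
apply: (@le_trans _ _ (K * T%:R ^+ n)); last first.
  by rewrite [leRHS]mulrAC [leRHS]mulrC; exact: ler_wpM2l.
rewrite /K -[leRHS]mulrA ler_wpM2l ?mulr_ge0 ?exprn_ge0// [leRHS]mulrDl lerD//.
  by rewrite -mulrA ler_wpM2l ?exprn_ge0.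
by rewrite -[leLHS]mulrnAr -[leRHS]mulrA ler_wpM2l ?mulr_ge0 ?exprn_ge0.
Qed.

End Total.

(** * The lower bound *)

Lemma frobenius_geN1 n (a : 'I_n -> nat) : primitive_vec a -> -1 <= frobenius a.
Proof. by move=> /frobeniusP[_]; apply. Qed.

(** The integer [h] is positive and smaller than all entries, hence not
representable. *)
Lemma frobenius_ge n (a : 'I_n -> nat) h : primitive_vec a -> (0 < h)%N ->
  (forall i, h < a i)%N -> h%:Z <= frobenius a.
Proof.
move=> /frobeniusP[_ ub] h0 ha; apply: ub => z [] hz.
have [/existsP[i zi]|/existsPn z0] := boolP [exists i, 0 < z i]%N.
  have : (a i * z i <= dot a z)%N by rewrite /dot (bigD1 i)//= leq_addr.
  rewrite -hz leqNgt => /negP[]; apply: leq_trans (ha i) _.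
  by rewrite leq_pmulr.
move: h0; rewrite hz /dot big1// => i _.
by have := z0 i; rewrite -eqn0Ngt => /eqP ->; rewrite muln0.
Qed.

(** A union bound over the position of the small entry. *)
Lemma card_G_small n T k : (k <= T)%N ->
  (#|[set a in G n T | [exists i, a i <= k]]| <= n * (k * T ^ n.-1))%N.
Proof.
move=> kT.
pose Q i (a : {ffun 'I_n -> 'I_T.+1}) :=
  a \in family (fun i' (v : 'I_T.+1) => 0 < v <= if i' == i then k else T)%N.
apply: (@leq_trans (\sum_(i < n) #|Q i|)).
  under [leqRHS]eq_bigr do rewrite -sum1_card big_mkcond.
  rewrite exchange_big -sum1_card big_mkcond; apply: leq_sum => a _.
  rewrite !inE; case: andP => // -[/andP[/forallP a0 _] /existsP[i ai]].
  rewrite (bigD1 i)//= (_ : a \in Q i)//.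
  apply/familyP => i'; rewrite unfold_in a0 /=.
  by case: eqP => [->|_] //; rewrite -ltnS.
rewrite -[X in (_ <= X * _)%N]card_ord -sum_nat_const; apply: leq_sum => i _.
have cnt u : (u <= T)%N -> (\sum_(v < T.+1 | 0 < v <= u) 1 = u)%N.
  move=> uT; rewrite -(big_mkord (fun v => 0 < v <= u)%N (fun=> 1%N)).
  rewrite -[RHS](_ : \sum_(1 <= v < u.+1) 1 = u)%N; last first.
    by rewrite sum_nat_const_nat muln1 subn1.
  rewrite (@big_nat_widenl _ _ _ 1 0)// (big_nat_widen 0 u.+1 T.+1)//.
rewrite -sum1_card (eq_bigr (fun a : {ffun 'I_n -> 'I_T.+1} => \prod_(i < n) 1)%N); last first.
  by move=> a _; rewrite big1.
rewrite -(bigA_distr_big_dep (fun i' (v : 'I_T.+1) => 0 < v <= if i' == i then k else T)%N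
  (fun _ _ => 1%N)) (bigD1 i)//= cnt eqxx// leq_mul2l; apply/orP; right.
rewrite (eq_bigr (fun=> T)); last by move=> i' /negPf ->; rewrite cnt.
by rewrite prod_nat_const cardC1 card_ord.
Qed.

Section Lower.
Variables (R : realType) (n : nat).
Hypothesis n_ge3 : (3 <= n)%N.

(** The product is at most [s ^ (2 n)], and [2 n <= 3 (n - 1)] for [n >= 3]. *)
Lemma root_prod_le s (a : 'I_n -> nat) : (0 < s)%N -> (forall i, a i <= s ^ 2)%N ->
  (\prod_i (a i)%:R) `^ (n%:R - 1)^-1 <= s%:R ^+ 3 :> R.
Proof.
move=> s0 aT; have [p pn] : exists p, n = p.+1 by case: n n_ge3 => // p _; exists p.
have p0 : (0 < p)%N by move: n_ge3; rewrite pn; lia.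
have hp : p%:R != 0 :> R by rewrite pnatr_eq0 -lt0n.
have -> : n%:R - 1 = p%:R :> R by rewrite pn -[p.+1%:R]natr1 addrK.
have -> : s%:R ^+ 3 = (s%:R ^+ (3 * p)) `^ p%:R^-1 :> R.
  by rewrite exprM -[_ ^+ 3 ^+ p]powR_mulrn ?exprn_ge0// -powRrM mulfV// powRr1// exprn_ge0.
rewrite ge0_ler_powR ?invr_ge0 ?nnegrE ?exprn_ge0 ?prodr_ge0//.
apply: (@le_trans _ _ (\prod_(i < n) s%:R ^+ 2)).
  by apply: ler_prod => i _; rewrite ler0n -natrX ler_nat aT.
rewrite prodr_const card_ord -exprM ler_weXn2l ?ler1n//.
by move: n_ge3; rewrite pn; lia.
Qed.

Lemma root_prod_ge1 (a : 'I_n -> nat) : (forall i, 0 < a i)%N ->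
  1 <= (\prod_i (a i)%:R) `^ (n%:R - 1)^-1 :> R.
Proof.
move=> a0; have e0 : 0 <= (n%:R - 1)^-1 :> R.
  by rewrite invr_ge0 subr_ge0 ler1n; lia.
have p1 : 1 <= \prod_i (a i)%:R :> R.
  by rewrite -natr_prod ler1n prodn_gt0.
have one : 1 `^ (n%:R - 1)^-1 = 1 :> R by rewrite powR1.
by rewrite -[leLHS]one ge0_ler_powR// nnegrE// (le_trans ler01).
Qed.

Lemma average_frobenius_gt0 : exists2 T, (0 < T)%N & 0 < average_frobenius R n T.
Proof.
(* [T] is a square to keep the normalization rational, and [w > 4 n] is what the
   final comparison [T ^ n / 4 * h / s ^ 3 > n T ^ (n - 1)] amounts to. *)
pose w := (4 * n).+1; pose s := (4 * n * w)%N; pose T := (s ^ 2)%N; pose h := (s * w)%N.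
have s0 : (0 < s)%N by rewrite /s /w; move: n_ge3; lia.
have h0 : (0 < h)%N by rewrite muln_gt0 s0.
have T0 : (0 < T)%N by rewrite expn_gt0 s0.
have hT : (4 * (n * h) = T)%N by rewrite /T /h -mulnn {3}/s; ring.
have hleT : (h <= T)%N by rewrite -hT; move: n_ge3; nia.
exists T => //; rewrite /average_frobenius divr_gt0 ?ltr0n ?G_gt0//; last by lia.
pose ones := [set a in G n T | [exists i, a i <= 1]]%N.
pose small := [set a in G n T | [exists i, a i <= h]]%N.
have sub : ones \subset small.
  apply/fintype.subsetP => a; rewrite !inE => /andP[-> /existsP[i ai]].
  by apply/existsP; exists i; rewrite (leq_trans ai).
have nf (a : {ffun 'I_n -> 'I_T.+1}) : a \in G n T ->
    (a \notin small)%:R * (h%:R / s%:R ^+ 3) - (a \in ones)%:R <=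
    normalized_frobenius R (vec a).
  move=> aG; have := aG; rewrite inE => prim.
  have a0 : forall i, (0 < a i)%N by case/andP: prim => /forallP.
  have N1 := root_prod_ge1 a0.
  have aT i : (a i <= s ^ 2)%N by rewrite -ltnS.
  have N3 := root_prod_le s0 aT.
  rewrite /normalized_frobenius; set N := _ `^ _ in N1 N3 *.
  have N0 : 0 < N by exact: lt_le_trans N1.
  have [aS|aS] := boolP (a \in small).
    rewrite mul0r sub0r; have [aO|aO] := boolP (a \in ones).
      rewrite ler_pdivlMr// mulN1r (@le_trans _ _ (-1))//.
        by rewrite lerN2.
      by rewrite -[-1]/((-1)%:~R) ler_int frobenius_geN1.
    rewrite oppr0 mulr_ge0 ?invr_ge0 ?(ltW N0)// ler0z.
    apply: (@le_trans _ _ 1%:Z) => //; apply: frobenius_ge => // i.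
    by move: aO; rewrite inE aG /= => /existsPn/(_ i); rewrite -ltnNge.
  have /negPf -> : a \notin ones by apply: contra aS; exact: (fintype.subsetP sub).
  rewrite mul1r subr0.
  have Fh : h%:R <= (frobenius (vec a))%:~R :> R.
    rewrite -[h%:R]/((Posz h)%:~R) ler_int; apply: frobenius_ge => // i.
    by move: aS; rewrite inE aG /= => /existsPn/(_ i); rewrite -ltnNge.
  by apply: ler_pM => //; rewrite lef_pV2 ?posrE ?exprn_gt0 ?ltr0n.
apply: lt_le_trans (ler_sum _ nf).
rewrite sumrB -mulr_suml -!natr_sum.
have -> : (\sum_(a in G n T) (a \in ones) = #|ones|)%N.
  rewrite -sum1_card big_mkcond [RHS]big_mkcond; apply: eq_bigr => a _.
  by rewrite [a \in ones]inE; case: (a \in G n T) => //=; case: ifP.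
have Gs : (\sum_(a in G n T) (a \notin small) + #|small| = #|G n T|)%N.
  rewrite -sum1_card -[in RHS]sum1_card big_mkcond [in X in (_ + X)%N]big_mkcond [RHS]big_mkcond.
  rewrite -big_split; apply: eq_bigr => a _ /=.
  by rewrite [a \in small]inE; case: (a \in G n T) => //=; case: ([exists _, _]).
set H := (\sum_(a in _) _)%N in Gs *.
have Tn : (T ^ n = T * T ^ n.-1)%N by rewrite -expnS prednK//; lia.
have H4 : (T ^ n <= 4 * H)%N.
  have := card_G_small n hleT; rewrite -/small => sm.
  have G2 := card_G_ge T n_ge3.
  have : (4 * (n * (h * T ^ n.-1)) = T ^ n)%N by rewrite Tn -[X in _ = (X * _)%N]hT; ring.
  by lia.
have O1 : (#|ones| <= n * T ^ n.-1)%N.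
  by have := card_G_small n T0; rewrite mul1n.
rewrite subr_gt0 mulrA ltr_pdivlMr ?exprn_gt0 ?ltr0n// -natrX -!natrM ltr_nat.
apply: (@leq_ltn_trans (n * T ^ n.-1 * s ^ 3)); first by rewrite leq_mul2r O1 orbT.
rewrite -(ltn_pmul2l (_ : 0 < 4)%N)//.
apply: (@leq_trans (T ^ n * h)); last by rewrite mulnA leq_mul2r H4 orbT.
rewrite Tn /h {2}/T.
have -> : (s ^ 2 * T ^ n.-1 * (s * w) = w * (T ^ n.-1 * s ^ 3))%N by ring.
have -> : (4 * (n * T ^ n.-1 * s ^ 3) = 4 * n * (T ^ n.-1 * s ^ 3))%N by ring.
by rewrite ltn_pmul2r// muln_gt0 !expn_gt0 s0.
Qed.

End Lower.

Local Open Scope classical_set_scope.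
Local Open Scope ring_scope.

Theorem corollary1 (R : realType) (n : nat) (n_ge3 : (3 <= n)%N) :
  exists c1 c2 : R, 0 < c1 /\ 0 < c2 /\
    (c1%:E <= ereal_sup [set (average_frobenius R n T)%:E | T in [set T | (0 < T)%N]])%E /\
    (ereal_sup [set (average_frobenius R n T)%:E | T in [set T | (0 < T)%N]] <= c2%:E)%E.
Proof.
have [T0 T0_gt0 avg_gt0] := average_frobenius_gt0 R n_ge3.
have [c c_gt0 hc] : exists2 c : R, 0 < c &
    forall T, (0 < T)%N -> average_frobenius R n T <= c.
  by case: n n_ge3 {avg_gt0} => // p p_ge2; exact: average_frobenius_le.
exists (average_frobenius R n T0), c; do 3!split => //.
  by apply: ereal_sup_ubound; exists T0.
by apply: ge_ereal_sup => _ [T T_gt0 <-]; rewrite lee_fin hc.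
Qed.
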